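(* Let $\mathcal F$ be a hereditary saturated formation of soluble groups with $(1)\neq \mathcal F\neq \mathcal S$, and let $\pi\subseteq \pi(\mathcal F)$ be a non-empty set of primes. Then the equality $$Z_{\pi\mathcal F}(G)=\mathrm{Int}_{\mathcal F}(G)$$ holds for every finite soluble group $G$ if and only if $\mathcal N\subseteq \mathcal F=\mathcal S_{\pi'}\mathcal F$ and $\mathcal F$ satisfies the $\pi$-boundary condition in the class $\mathcal S$ of all soluble groups.
   Context: All groups are finite. $\mathcal S$ is the class of all soluble groups, $\mathcal N$ the class of all nilpotent groups, $(1)$ the class of all identity groups. $\pi'$ is the complement of $\pi$ in the set $\mathbb P$ of all primes; $\mathcal S_{\pi'}$ is the class of all soluble $\pi'$-groups, with $\mathcal S_{\varnothing}=(1)$. $\pi(\mathcal F)$ is the set of all primes dividing the order of some group in $\mathcal F$. Formations. For a class $\mathcal F$ containing the identity group, $G^{\mathcal F}$ is the intersection of all normal subgroups $N$ of $G$ with $G/N\in\mathcal F$. A formation is a class $\mathcal F$ of groups closed under homomorphic images and such that, if $\mathcal F\neq\varnothing$, $G/G^{\mathcal F}\in\mathcal F$ for every group $G$. It is saturated if $G\in\mathcal F$ whenever $G/\Phi(G)\in\mathcal F$, and hereditary if $H\le G\in\mathcal F$ implies $H\in\mathcal F$. For classes $\mathcal X,\mathcal F$, the product $\mathcal X\mathcal F$ is the class of all groups $G$ with $G^{\mathcal F}\in\mathcal X$. Canonical local satellite. For a function $f$ from primes to formations, $LF(f)$ is the class of all groups $G$ such that $G=1$ or $G/C_G(H/K)\in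 f(p)$ for every chief factor $H/K$ of $G$ and every prime $p$ dividing $|H/K|$. Every non-empty saturated formation $\mathcal F$ has a unique function $F$ (its canonical local satellite) with $\mathcal F=LF(F)$ such that for every prime $p$: $F(p)\subseteq\mathcal F$, and $G\in F(p)$ whenever $G/O_p(G)\in F(p)$. Boundary condition. For a class $\mathcal Y$, a group is $\mathcal Y$-critical if it is not in $\mathcal Y$ but all its proper subgroups are. $\mathcal F$ satisfies the $\pi$-boundary condition in a class $\mathcal X$ if every group $G\in\mathcal X$ that is $F(p)$-critical for at least one $p\in\pi$ belongs to $\mathcal F$. Hypercentre. A chief factor $H/K$ of $G$ is $\mathcal F$-central in $G$ if $(H/K)\rtimes (G/C_G(H/K))\in\mathcal F$. $Z_{\pi\mathcal F}(G)$ is the product of all normal subgroups $N$ of $G$ such that either $N=1$ or every chief factor of $G$ below $N$ of order divisible by at least one prime in $\pi$ is $\mathcal F$-central in $G$. A subgroup $U$ of $G$ is $\mathcal F$-maximal in $G$ if $U\in\mathcal F$ and $U\le V\le G$, $V\in\mathcal F$ imply $U=V$. $\mathrm{Int}_{\mathcal F}(G)$ is the intersection of all $\mathcal F$-maximal subgroups of $G$. *)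

(* Defs.v *)
From HB Require Import structures.
From mathcomp Require Import all_boot all_fingroup all_solvable.
From mathcomp Require Import boolp.

Set Implicit Arguments.
Unset Strict Implicit.
Unset Printing Implicit Defensive.

Import GroupScope.

(* A class of finite groups. Invariance under isomorphism is not part of the
   type; it is implied by [hom_closed] below. *)
Definition group_class := forall gT : finGroupType, {group gT} -> Prop.

Definition class_sub (X Y : group_class) : Prop :=
  forall (gT : finGroupType) (G : {group gT}), X gT G -> Y gT G.

Definition class_eq (X Y : group_class) : Prop :=
  forall (gT : finGroupType) (G : {group gT}), X gT G <-> Y gT G.

Definition class_nonempty (X : group_class) : Prop :=
  exists (gT : finGroupType) (G : {group gT}), X gT G.

Definition soluble_groups : group_class := fun gT G => solvable G.

Definition nilpotent_groups : group_class := fun gT G => nilpotent G.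

Definition trivial_groups : group_class := fun gT G => G :=: 1.

Definition soluble_pi'_groups (pi : nat_pred) : group_class :=
  fun gT G => solvable G /\ pi^'.-group G.

Definition class_prime (F : group_class) (p : nat) : Prop :=
  prime p /\ exists (gT : finGroupType) (G : {group gT}), F gT G /\ p %| #|G|.

(* Only meaningful when [F] contains the identity groups: otherwise the
   intersection may be empty, and then denotes the whole type. *)
Definition residual (F : group_class) (gT : finGroupType) (G : {group gT}) :
    {group gT} :=
  [group of \bigcap_(N : {group gT} | (N <| G) && `[< F _ (G / N)%G >]) N].

Definition class_prod (X F : group_class) : group_class :=
  fun gT G => X gT (residual F G).

Definition hom_closed (F : group_class) : Prop :=
  forall (gT rT : finGroupType) (G : {group gT}) (f : {morphism G >-> rT}),
    F gT G -> F rT (f @* G)%G.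

Definition formation (F : group_class) : Prop :=
  hom_closed F /\
  (class_nonempty F ->
   forall (gT : finGroupType) (G : {group gT}), F _ (G / residual F G)%G).

Definition saturated (F : group_class) : Prop :=
  forall (gT : finGroupType) (G : {group gT}), F _ (G / 'Phi(G))%G -> F gT G.

Definition hereditary (F : group_class) : Prop :=
  forall (gT : finGroupType) (G H : {group gT}),
    H \subset G -> F gT G -> F gT H.

(* [chief_factor G K H] is the library predicate for "H/K is a chief factor of
   G", and ['Q] is the conjugation action on cosets of [K]. *)
Definition chief_cent (gT : finGroupType) (G H K : {group gT}) : {group gT} :=
  'C_G(H / K | 'Q)%G.

(* Functions from primes to classes are functions on [nat] whose values at
   non-primes are irrelevant. *)
Definition LF (f : nat -> group_class) : group_class := fun gT G =>
  G :=: 1 \/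
  forall H K : {group gT}, chief_factor G K H ->
  forall p : nat, prime p -> p %| #|H / K| -> f p _ (G / chief_cent G H K)%G.

Definition canonical_local_satellite (F : group_class)
    (f : nat -> group_class) : Prop :=
  [/\ forall p, prime p -> formation (f p),
      class_eq F (LF f),
      forall p, prime p -> class_sub (f p) F
    & forall p, prime p -> forall (gT : finGroupType) (G : {group gT}),
        f p _ (G / 'O_p(G))%G -> f p gT G].

Definition critical (Y : group_class) : group_class := fun gT G =>
  ~ Y gT G /\ forall H : {group gT}, H \proper G -> Y gT H.

(* [f] stands for the canonical local satellite of [F]. *)
Definition boundary_condition (pi : nat_pred) (F : group_class)
    (f : nat -> group_class) (X : group_class) : Prop :=
  forall (gT : finGroupType) (G : {group gT}), X gT G ->
    (exists2 p, p \in pi & critical (f p) G) -> F gT G.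

(* The conjugation action of G / C_G(H/K) on H/K. The library extends it to an
   action of N(K) / C_G(H/K) on the centraliser of C_G(H/K) in N(K) / K, so the
   semidirect product of H/K and G / C_G(H/K) is cut out of the larger one
   defined by the extended action; see [chief_sdprodP]. *)
Definition chief_action (gT : finGroupType) (G H K : {group gT}) :=
  (('J / K) %% chief_cent G H K)%gact.

Definition chief_sdprod (gT : finGroupType) (G H K : {group gT}) :
    {group sdprod_by (chief_action G H K)} :=
  (sdpair1 (chief_action G H K) @* (H / K) <*>
   sdpair2 (chief_action G H K) @* (G / chief_cent G H K))%G.

Section ChiefSdprod.

Variables (gT : finGroupType) (G H K : {group gT}).
Let C := chief_cent G H K.
Let to := chief_action G H K.

Lemma chief_sdprodP : chief_factor G K H ->
  [/\ sdpair1 to @* (H / K) ><| sdpair2 to @* (G / C) = chief_sdprod G H K,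
      H / K \isog sdpair1 to @* (H / K),
      G / C \isog sdpair2 to @* (G / C)
    & {in H & G, forall h g, sdpair1 to (coset K h) ^ sdpair2 to (coset C g)
                             = sdpair1 to (coset K (h ^ g))}].
Proof.
case/andP=> /maxgroupp/andP[/proper_sub sKH nKG] /andP[sHG nHG].
have nKH : H \subset 'N(K) := subset_trans sHG nKG.
have sCQ : C \subset 'C(H / K | 'Q) by apply: subsetIr.
have nCG : G \subset 'N(C).
  by rewrite normsI ?normG // (subset_trans (actsQ nKG nHG)) ?astab_norm.
have sHR : H / K \subset 'C_(|('J / K)%gact)(C).
  by rewrite gacentQ centsC; move: sCQ; rewrite sub_astabQ => /andP[].
have sGD : G / C \subset qact_dom 'J K / C by rewrite quotientS // dom_qactJ.
have act_conj : {in H & G, forall h g,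
    to (coset K h) (coset C g) = coset K (h ^ g)}.
  move=> h g Hh Gg; have [nKh nKg] := (subsetP nKH h Hh, subsetP nKG g Gg).
  rewrite /to /chief_action /= modactE ?dom_qactJ ?(subsetP nCG) //.
  - by rewrite qactJ nKg morphJ.
  - by rewrite /= dom_qactJ.
  by have /setIP[] := subsetP sHR _ (mem_quotient K Hh).
have sdJ : {in H & G, forall h g, sdpair1 to (coset K h) ^ sdpair2 to (coset C g)
                                = sdpair1 to (coset K (h ^ g))}.
  move=> h g Hh Gg; rewrite -act_conj // sdpair_act //.
    by rewrite (subsetP sHR) ?mem_quotient.
  by rewrite (subsetP sGD) ?mem_quotient.
split=> //.
- rewrite sdprodEY //.
    apply/subsetP=> _ /morphimP[_ _ /morphimP[g _ Gg ->] ->].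
    rewrite inE; apply/subsetP=> _ /imsetP[_ /morphimP[_ _ /morphimP[h _ Hh ->] ->] ->].
    rewrite /= sdJ // mem_morphim ?mem_quotient ?memJ_norm ?(subsetP nHG) //.
    by rewrite (subsetP sHR) // mem_quotient // memJ_norm // (subsetP nHG).
  apply/trivgP; rewrite -(im_sdpair_TI to).
  by apply: setISS; apply: morphimS.
- by apply: (sub_isog (f := sdpair1_morphism to)) => //; apply: injm_sdpair1.
- by apply: (sub_isog (f := sdpair2_morphism to)) => //; apply: injm_sdpair2.
Qed.

End ChiefSdprod.

Definition central_chief (F : group_class) (gT : finGroupType)
    (G H K : {group gT}) : Prop :=
  F _ (chief_sdprod G H K).

Definition hypercentral (pi : nat_pred) (F : group_class) (gT : finGroupType)
    (G N : {group gT}) : Prop :=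
  N :=: 1 \/
  forall H K : {group gT}, chief_factor G K H -> H \subset N ->
    (exists p, [/\ p \in pi, prime p & p %| #|H / K|]) ->
    central_chief F G H K.

Definition hypercentre (pi : nat_pred) (F : group_class) (gT : finGroupType)
    (G : {group gT}) : {group gT} :=
  (\prod_(N : {group gT} | (N <| G) && `[< hypercentral pi F G N >]) N)%G.

Definition class_maximal (F : group_class) (gT : finGroupType)
    (G U : {group gT}) : Prop :=
  [/\ U \subset G, F gT U
    & forall V : {group gT}, U \subset V -> V \subset G -> F gT V -> U :=: V].

Definition class_Int (F : group_class) (gT : finGroupType) (G : {group gT}) :
    {group gT} :=
  [group of \bigcap_(U : {group gT} | `[< class_maximal F G U >]) U].

(* Main.v *)
Require Import Defs.
From mathcomp Require Import all_boot all_fingroup all_solvable.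
From mathcomp Require Import ssralg finalg zmodp matrix mxrepresentation mxabelem.
From mathcomp Require Import boolp.

(** Let f be the canonical local satellite of F and let p be a prime in the
    characteristic of F. Everything rests on a dictionary between F and f(p).
    If S is in F and B is a normal p-subgroup of S, then S / C_S(B) is in f(p)
    ([satellite_cent]): modulo the centralisers of the chief factors below B
    the quotient is in f(p), and what these centralisers have in common acts
    on B as a p-group, which f(p) absorbs. Conversely, if N is a normal
    p-subgroup of E with E / N in F and E / C_E(N) in f(p), then E is in F
    ([satellite_extension]). Using a faithful module in characteristic p, the
    dictionary shows that f(p) inherits heredity from F
    ([satellite_hereditary]), and that a p-chief factor H / K of G is
    F-central if and only if G / C_G(H / K) is in f(p) ([central_chiefP]).

    Sufficiency. Walking down a G-series of the hypercentre Z, the equality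
    F = S_pi' F (for the pi'-factors) and [satellite_extension] (for the
    p-factors with p in pi) show that a subgroup E containing Z is in F as
    soon as E / Z is ([central_series_lift]). Hence U Z is in F for every
    F-maximal U, so that Z lies in all of them. For the reverse inclusion,
    let H / K be a p-chief factor of G below Int(G), with p in pi and
    centraliser C, and suppose that G / C is not in f(p). A subgroup E
    minimal subject to E / C not in f(p) has an f(p)-critical image, which
    the boundary condition puts in F; by minimality E meets C inside Phi(E),
    so E is in F by saturation. Some F-maximal U contains E, and also H since
    H is below Int(G); the dictionary in U then puts E / C in f(p), a
    contradiction ([Int_hypercentral]).

    Necessity. Each condition is read off from the equality on one family of
    groups. In a group of prime order outside the characteristic of F the
    hypercentre is everything while Int is trivial ([class_prime_of_eq]). If
    the F-residual R of G is a soluble pi'-group, it lies in the hypercentre,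
    hence in Int(G), and an F-subgroup supplementing R sits in an F-maximal
    subgroup, which must be G ([class_prod_of_eq]). If G is f(p)-critical but
    not in F, take a faithful module B of G in characteristic p: in
    W = B G every F-subgroup U has B U < W, so B U is in F. Thus B is in
    Int(W), so in the hypercentre, and the action of W on B, which is that of
    G, is in f(p) after all ([boundary_of_eq]). *)

Set Implicit Arguments.
Unset Strict Implicit.
Unset Printing Implicit Defensive.

Import GroupScope.

(** * Formations and their residuals *)

Section Formations.

Variable Y : group_class.
Arguments Y : clear implicits.
Hypothesis formY : formation Y.

Let homY : hom_closed Y := proj1 formY.

Lemma formation_homg (aT rT : finGroupType) (G : {group aT}) (H : {group rT}) :
  H \homg G -> Y _ G -> Y _ H.
Proof.
by case/homgP=> f /group_inj<-; apply: homY.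
Qed.

Lemma formation_isog (aT rT : finGroupType) (G : {group aT}) (H : {group rT}) :
  G \isog H -> Y _ G -> Y _ H.
Proof. by rewrite isog_sym => /isog_hom; apply: formation_homg. Qed.

Lemma formation_quo (gT : finGroupType) (G M N : {group gT}) :
    G \subset 'N(M) -> G \subset 'N(N) -> M \subset N ->
  Y _ (G / M)%G -> Y _ (G / N)%G.
Proof. by move=> nMG nNG sMN; apply: formation_homg; apply: homg_quotientS. Qed.

Lemma formation1 (aT rT : finGroupType) (G : {group aT}) (H : {group rT}) :
  Y _ G -> H :=: 1 -> Y _ H.
Proof.
move=> YG H1; apply: formation_homg YG; apply/homgP.
by exists (trivm G); rewrite H1 morphim_trivm.
Qed.

Lemma residual_min (gT : finGroupType) (G N : {group gT}) :
  N <| G -> Y _ (G / N)%G -> residual Y G \subset N.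
Proof. by move=> nsNG YGN; apply: bigcap_inf; rewrite nsNG; apply/asboolP. Qed.

Lemma residual_norm (gT : finGroupType) (G : {group gT}) :
  G \subset 'N(residual Y G).
Proof.
by apply: norms_bigcap; apply/bigcapsP=> N /andP[/normal_norm].
Qed.

Lemma formation_residual (aT gT : finGroupType) (A : {group aT})
    (G : {group gT}) :
  Y _ A -> Y _ (G / residual Y G)%G.
Proof. by move=> YA; apply: (proj2 formY); exists aT, A. Qed.

Lemma formation_quoI (gT : finGroupType) (G M N : {group gT}) :
    M <| G -> N <| G -> Y _ (G / M)%G -> Y _ (G / N)%G -> Y _ (G / (M :&: N))%G.
Proof.
move=> nsMG nsNG YM YN.
apply: formation_quo (formation_residual _ YM).
- exact: residual_norm.
- by rewrite normsI ?normal_norm.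
- by rewrite subsetI !residual_min.
Qed.

End Formations.

(** * Formations closed under extension by normal p-subgroups *)

Section SatelliteAt.

Variables (p : nat) (Y : group_class).
Arguments Y : clear implicits.
Hypothesis formY : formation Y.
Hypothesis pY : forall (gT : finGroupType) (G : {group gT}),
  Y _ (G / 'O_p(G))%G -> Y _ G.

Lemma p_extension_closed (gT : finGroupType) (G P : {group gT}) :
  P <| G -> p.-group P -> Y _ (G / P)%G -> Y _ G.
Proof.
move=> nsPG pP YGP; apply: pY; apply: formation_quo YGP => //.
- exact: normal_norm.
- by rewrite gFnorm.
- by rewrite pcore_max.
Qed.

Lemma p_extension_quo (gT : finGroupType) (G M N : {group gT}) :
    M <| G -> N <| G -> M \subset N -> p.-group (N / M) ->
  Y _ (G / N)%G -> Y _ (G / M)%G.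
Proof.
move=> nsMG nsNG sMN pNM YGN.
apply: (p_extension_closed (quotient_normal M nsNG) pNM).
by apply: (formation_isog formY) YGN; rewrite isog_sym third_isog.
Qed.

End SatelliteAt.

(** * Coprime action, chief factors and modules *)

(** A p'-element of X acts coprimely on N and trivially on the two factors of
    the series 1 <= M <= N, hence trivially on N. *)
Lemma pgroup_stabilizer (p : nat) (gT : finGroupType) (X M N : {group gT}) :
    p.-group N -> M <| N -> X \subset 'N(N) -> [~: N, X] \subset M ->
    X \subset 'C(M) -> p.-group (X / 'C_X(N)).
Proof.
move=> pN nsMN nNX sNXM cMX; have [sMN nMN] := andP nsMN.
have nMX: X \subset 'N(M) by rewrite cents_norm.
have nCX: X \subset 'N('C_X(N)) by rewrite normsI ?normG ?norms_cent.
apply/pgroupP=> q q_pr /Cauchy[//|xb Xxb oxb].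
case/morphimP: Xxb oxb => x nCx Xx ->{xb} oxb.
set y := x.`_p^'; have Xy: y \in X by rewrite groupX.
suffices cNy: y \in 'C_X(N).
  suffices : p.-elt (coset 'C_X(N) x) by rewrite /p_elt oxb pnatE.
  rewrite -(consttC p x) morphM ?(subsetP nCX) ?groupX //= (coset_id cNy) mulg1.
  by rewrite morph_p_elt ?(subsetP nCX) ?groupX ?p_elt_constt.
have coNy: coprime #|N| #|<[y]>|.
  by rewrite (pnat_coprime pN) // [_.-nat _]p_elt_constt.
have sNC: N \subset M * 'C_N(<[y]>).
  have nMy : <[y]> \subset 'N(M) by rewrite cycle_subG (subsetP nMX).
  rewrite -quotientSK // coprime_quotient_cent ?(pgroup_sol pN) //.
  rewrite subsetI subxx quotient_cents2 //.
  by apply: subset_trans sNXM; rewrite commgS ?cycle_subG.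
rewrite in_setI Xy -cycle_subG centsC (subset_trans sNC) // mul_subG ?subsetIr //.
by rewrite centsC cycle_subG (subsetP cMX).
Qed.

(** Commutators are insensitive to passing to subgroups and quotients, whereas
    the action on cosets changes type each time; all comparisons of
    centralisers of factors below go through this form. *)
Lemma chief_centP (gT : finGroupType) (G H K X : {group gT}) :
    G \subset 'N(K) -> H \subset 'N(K) ->
  (X \subset chief_cent G H K) = (X \subset G) && ([~: X, H] \subset K).
Proof.
move=> nKG nKH; rewrite subsetI; case sXG: (X \subset G) => //=.
have nKX := subset_trans sXG nKG.
by rewrite sub_astabQ nKX quotient_cents2.
Qed.

Lemma chief_cent_comm (gT : finGroupType) (G H K : {group gT}) :
    G \subset 'N(K) -> H \subset 'N(K) -> [~: chief_cent G H K, H] \subset K.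
Proof.
move=> nKG nKH; have := chief_centP (chief_cent G H K) nKG nKH.
by rewrite subxx => /esym/andP[].
Qed.

Lemma chief_cent_normal (gT : finGroupType) (G H K : {group gT}) :
  G \subset 'N(K) -> G \subset 'N(H) -> chief_cent G H K <| G.
Proof.
move=> nKG nHG; rewrite /normal subsetIl normsI ?normG //.
by rewrite (subset_trans (actsQ nKG nHG)) ?astab_norm.
Qed.

(** H / K and HN / KN are isomorphic as E-groups when H meets N inside K. The
    last item transfers centralisers back from E / N to E. *)
Lemma chief_factor_quotient (gT : finGroupType) (E H K N : {group gT}) :
    chief_factor E K H -> N <| E -> H :&: N \subset K ->
  [/\ chief_factor (E / N) (K / N) (H / N),
      #|(H / N) / (K / N)| = #|H / K|
    & forall L : {group gT}, L <| E ->
        [~: L / N, H / N] \subset K / N -> [~: L, H] \subset K].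
Proof.
move=> chKH nsNE sHNK; have [sNE nNE] := andP nsNE.
case/andP: chKH => /maxgroupP[/andP[ltKH nKE] maxK] nsHE.
have [sHE nHE] := andP nsHE; have sKH := proper_sub ltKH.
have sKE := subset_trans sKH sHE.
have [nNH nNK] := (subset_trans sHE nNE, subset_trans sKE nNE).
have defK (A : {group gT}) : A \subset H -> A \subset N * K -> A \subset K.
  move=> sAH sANK; apply/subsetP=> x Ax.
  have /mulsgP[n k Nn Kk defx] := subsetP sANK x Ax; rewrite defx groupM //.
  rewrite (subsetP sHNK) // inE Nn andbT -(mulgK k n) -defx.
  by rewrite groupM ?groupV ?(subsetP sAH x) ?(subsetP sKH k).
have sKNHN : H / N \subset K / N = (H \subset K).
  apply/idP/idP => [|/quotientS->//]; rewrite quotientSK //; exact: defK.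
split.
- rewrite /chief_factor quotient_normal // andbT; apply/maxgroupP; split.
    rewrite quotient_norms // properE quotientS //= sKNHN andbT.
    exact: proper_subn ltKH.
  move=> Xb /andP[ltXH nXE] sKX.
  have nsXE : Xb <| E / N.
    by rewrite /normal nXE (subset_trans (proper_sub ltXH)) ?quotientS.
  have [X defX sNX nsXE'] := inv_quotientN nsNE nsXE.
  have sXH : X \subset N * H.
    rewrite -quotientSK -?defX ?(proper_sub ltXH) //.
    exact: subset_trans (normal_sub nsXE') nNE.
  have sKX' : K \subset X by rewrite defX quotientSGK in sKX.
  have defXH : (X :&: H)%G :=: K.
    apply: maxK; last by rewrite subsetI sKX'.
    rewrite normsI ?(normal_norm nsXE') // andbT properE subsetIr.
    apply: contra (proper_subn ltXH); rewrite subsetI subxx andbT defX => sHX.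
    exact: quotientS.
  apply/eqP; rewrite eqEsubset sKX andbT defX quotientSK //; last first.
    exact: subset_trans (normal_sub nsXE') nNE.
  by rewrite -defXH /= setIC group_modl // subsetI sXH subxx.
- have nKH := subset_trans sHE nKE.
  by rewrite !card_quotient ?quotient_norms // index_quotient_eq.
- move=> L nsLE; have [sLE nLE] := andP nsLE.
  have nNL := subset_trans sLE nNE.
  have sLH : [~: L, H] \subset H by rewrite commg_subr (subset_trans sLE).
  rewrite -quotientR // quotientSK; first exact: defK.
  exact: subset_trans sLH nNH.
Qed.

(** The regular representation over the prime field is a faithful module; W is
    its semidirect product with G. *)
Lemma faithful_module_exists (p : nat) (gT : finGroupType) (G : {group gT}) :
    prime p ->
  exists (wT : finGroupType) (W B Q : {group wT}),
    [/\ B ><| Q = W, p.-group B /\ abelian B, 'C_Q(B) = 1 & G \isog Q].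
Proof.
move=> p_pr; pose to := ('MR (regular_repr 'F_p G))%gact.
exists (sdprod_by to), [set: sdprod_by to]%G.
exists (sdpair1 to @* setT)%G, (sdpair2 to @* G)%G; split.
- exact: sdprod_sdpair.
- split; last by apply: morphim_abelian; apply: FinRing.zmod_abelian.
  rewrite /pgroup card_injm ?injm_sdpair1 ?subsetT // cardsT card_mx card_Fp //.
  by rewrite pnatX pnat_id.
- apply/trivgP/subsetP=> _ /setIP[/morphimP[x _ Gx ->] cBx].
  have kerx: x \in rker (regular_repr 'F_p G).
    have: x \in 'C(setT | to) by rewrite astabEsd ?subsetT // inE Gx inE.
    move=> cTx; rewrite !inE Gx mul1mx; apply/eqP/row_matrixP=> i.
    have Te: (row i 1%:M)%R \in [set: 'rV['F_p]_(gcard G)] by rewrite inE.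
    by have:= astab_act cTx Te; rewrite /= mx_repr_actE // -row_mul mul1mx.
  have /set1P-> := subsetP (regular_mx_faithful _ _) _ kerx.
  by rewrite morph1 inE.
- by apply: (sub_isog (f := sdpair2_morphism to)) => //; apply: injm_sdpair2.
Qed.

(** * The dictionary between a saturated formation and its satellite *)

Section Main.

Variables (F : group_class) (f : nat -> group_class).
Arguments F : clear implicits.
Arguments f : clear implicits.
Hypothesis formF : formation F.
Hypothesis satF : saturated F.
Hypothesis herF : hereditary F.
Hypothesis solF : class_sub F soluble_groups.
Hypothesis locF : canonical_local_satellite F f.

Section AtPrime.

Variable p : nat.
Hypothesis Fp : class_prime F p.

Let p_pr : prime p := proj1 Fp.

Let formf : formation (f p).
Proof. by have [h _ _ _] := locF; apply: h. Qed.

Let pf (gT : finGroupType) (G : {group gT}) :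
  f p _ (G / 'O_p(G))%G -> f p gT G.
Proof. by have [_ _ _ h] := locF; apply: h. Qed.

Lemma satellite_sub : class_sub (f p) F.
Proof. by have [_ _ h _] := locF; apply: h. Qed.

Lemma satellite_chief (q : nat) (gT : finGroupType) (S H K : {group gT}) :
    prime q -> F gT S -> chief_factor S K H -> q %| #|H / K| ->
  f q _ (S / chief_cent S H K)%G.
Proof.
move=> q_pr; have [_ eqF _ _] := locF; rewrite eqF => -[S1 | LFS] chKH.
  case/andP: chKH => /maxgroupp/andP[ltKH _] /andP[sHS _].
  rewrite S1 in sHS; have := proper_sub_trans ltKH sHS.
  by rewrite properE sub1G andbF.
by move=> qHK; apply: LFS.
Qed.

(** The group of order p below is its own chief factor, so f(p) is not empty;
    as a formation it then contains the identity groups. *)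
Lemma satellite_has1 (gT : finGroupType) (G : {group gT}) :
  G :=: 1 -> f p gT G.
Proof.
have [_ [aT [A [FA pA]]]] := Fp; have [x Ax ox] := Cauchy p_pr pA.
have FX: F aT <[x]>%G by apply: herF FA; rewrite cycle_subG.
have ch1: chief_factor <[x]> 1 <[x]>.
  rewrite /chief_factor normal_refl andbT; apply/maxgroupP; split=> [|H].
    by rewrite norms1 andbT proper1G cycle_eq1 -order_gt1 ox prime_gt1.
  case/andP=> ltHx _ _; apply/trivgP.
  have [| sxH | <-] := @prime_subgroupVti _ <[x]> H; first by rewrite [#|_|]ox.
    by case/andP: ltHx => _ /negP[].
  by rewrite subsetI subxx proper_sub.
have pX: p %| #|<[x]> / 1| by rewrite -(card_isog (quotient1_isog _)) [#|_|]ox.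
by move=> G1; apply: (formation1 formf (satellite_chief p_pr FX ch1 pX)).
Qed.

(** The intersection of C_S(M) and X stabilises the series 1 <= M <= N, so it
    acts on N as a p-group, and f(p) absorbs normal p-subgroups. *)
Lemma satellite_cent_step (gT : finGroupType) (S X M N : {group gT}) :
    p.-group N -> N <| S -> M <| S -> M \subset N -> X <| S ->
    [~: N, X] \subset M ->
    f p _ (S / 'C_S(M))%G -> f p _ (S / X)%G -> f p _ (S / 'C_S(N))%G.
Proof.
move=> pN nsNS nsMS sMN nsXS sNXM fM fX.
have nsC (A : {group gT}) : A <| S -> 'C_S(A) <| S.
  by case/andP=> _ nAS; rewrite /normal subsetIl normsI ?normG ?norms_cent.
pose Y := ('C_S(M) :&: X)%G.
have nsYS : Y <| S by rewrite normalI ?nsC.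
have sCY : 'C_Y(N) \subset Y by apply: subsetIl.
have fY : f p _ (S / Y)%G by apply: formation_quoI fX; rewrite ?nsC.
have sYX : Y \subset X := subsetIr _ _.
have sYS := normal_sub nsYS.
have nsCYS : 'C_Y(N) <| S.
  by rewrite /normal subIset ?sYS // normsI ?norms_cent ?normal_norm.
suffices fC : f p _ (S / 'C_Y(N))%G.
  apply: formation_quo fC => //; rewrite ?normal_norm ?nsC //.
  by rewrite setSI.
apply: (p_extension_quo formf (@pf) nsCYS nsYS sCY _ fY).
apply: pgroup_stabilizer pN _ _ _ _.
- exact: normalS sMN (normal_sub nsNS) nsMS.
- by rewrite (subset_trans sYS) ?normal_norm.
- by apply: subset_trans sNXM; rewrite commgS.
- by rewrite subIset // subsetIr.
Qed.

(** By induction along a chief series of S below B. *)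
Lemma satellite_cent (gT : finGroupType) (S B : {group gT}) :
  F gT S -> B <| S -> p.-group B -> f p _ (S / 'C_S(B))%G.
Proof.
move=> FS; have [m] := ubnP #|B|; elim: m B => // m IHm B /ltnSE-leBm nsBS pB.
have [-> | ntB] := eqVneq B 1%G.
  by apply: satellite_has1; rewrite /= cent1T setIT trivg_quotient.
have [M maxM]: {M : {group gT} | maxnormal M B S}.
  by apply: ex_maxgroup; exists 1%G; rewrite proper1G ntB norms1.
have /andP[ltMB nMS] := maxgroupp maxM; have sMB := proper_sub ltMB.
have chMB: chief_factor S M B by rewrite /chief_factor maxM.
have nsMS: M <| S by rewrite /normal nMS andbT (subset_trans sMB) ?normal_sub.
have nMB: B \subset 'N(M) by rewrite (subset_trans (normal_sub nsBS)).
have pBM: p %| #|B / M|.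
  have [|//] := @pgroup_pdiv _ p (B / M)%G (quotient_pgroup M pB).
  by rewrite quotient_neq1 // /normal sMB.
have nsCS := chief_cent_normal nMS (normal_norm nsBS).
have fC := satellite_chief p_pr FS chMB pBM.
apply: (satellite_cent_step pB nsBS nsMS sMB nsCS _ _ fC).
  by rewrite commGC chief_cent_comm.
apply: IHm => //; first exact: leq_trans (proper_card ltMB) _.
exact: pgroupS sMB pB.
Qed.

Lemma satellite_section_cent (gT : finGroupType) (S M N : {group gT}) :
    F gT S -> M <| S -> N <| S -> M \subset N -> p.-group (N / M) ->
  f p _ (S / chief_cent S N M)%G.
Proof.
move=> FS nsMS nsNS sMN pNM.
have [nMS nNS] := (normal_norm nsMS, normal_norm nsNS).
have nMN := subset_trans (normal_sub nsNS) nMS.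
have FSM : F _ (S / M)%G by apply: formation_homg FS => //; apply: quotient_homg.
have := satellite_cent FSM (quotient_normal M nsNS) pNM.
have nsC : 'C_(S / M)(N / M) <| S / M.
  by rewrite /normal subsetIl normsI ?normG ?norms_cent ?quotient_norms.
have [L defL sML nsLS] := inv_quotientN nsMS nsC.
have iso := third_isog sML nsMS nsLS; rewrite -defL in iso.
move/(formation_isog formf iso); apply: formation_quo => //.
- exact: normal_norm.
- by rewrite normal_norm // chief_cent_normal.
- rewrite chief_centP // normal_sub //= -quotient_cents2 //; last first.
    by rewrite (subset_trans (normal_sub nsLS)).
  by rewrite -defL subsetIr.
Qed.

(** For G in f(p) with faithful module B, the semidirect product B G is in f(p),
    hence in F, and so is B H. Since B is abelian and self-centralising in B H,
    [satellite_cent] returns H as the group that B H induces on B. *)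
Lemma satellite_hereditary : hereditary (f p).
Proof.
move=> gT G H sHG fG.
have [wT [W [B [Q [defW [pB abB] CQB isoGQ]]]]] := faithful_module_exists G p_pr.
have [nsBW sQW defBQ nBQ tiBQ] := sdprod_context defW.
have isoQ : Q \isog W / B by apply: sdprod_isog defW.
have FW : F _ W.
  apply: satellite_sub; apply: (p_extension_closed formf (@pf) nsBW pB).
  exact: (formation_isog formf (isog_trans isoGQ isoQ)).
have [g injg imG] := isogP isoGQ; pose R := (g @* H)%G.
have sRQ : R \subset Q by rewrite -imG morphimS.
have nBR : R \subset 'N(B) := subset_trans sRQ nBQ.
have isoHR : H \isog R by apply: (sub_isog (f := g)).
pose S := (B <*> R)%G.
have nsBS : B <| S by rewrite /normal joing_subl join_subG normG.
have FS : F _ S.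
  by apply: herF FW; rewrite join_subG (normal_sub nsBW) (subset_trans sRQ).
have nCS : S \subset 'N('C_S(B)).
  by rewrite normsI ?norms_cent ?normG ?normal_norm.
have nCR : R \subset 'N('C_S(B)) := subset_trans (joing_subr B R) nCS.
have tiCR : 'C_S(B) :&: R = 1.
  by apply/trivgP; rewrite -CQB setIC setISS ?subsetIr.
have defSC : (R / 'C_S(B))%G = (S / 'C_S(B))%G.
  apply/group_inj/eqP; rewrite eqEsubset quotientS ?joing_subr //= quotientSK //.
  have sBC : B \subset 'C_S(B) by rewrite subsetI joing_subl.
  by apply: subset_trans (mulSg R sBC); rewrite -norm_joinEr.
have isoHC := isog_trans isoHR (quotient_isog nCR tiCR).
rewrite isog_sym in isoHC.
by apply: (formation_isog formf isoHC); rewrite defSC; apply: satellite_cent.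
Qed.

Lemma satellite_sub_quo (gT : finGroupType) (U E C D : {group gT}) :
    E \subset U -> U \subset 'N(C) -> E \subset 'N(D) -> C :&: E \subset D ->
  f p _ (U / C)%G -> f p _ (E / D)%G.
Proof.
move=> sEU nCU nDE sCED fUC; have nCE := subset_trans sEU nCU.
have fEC : f p _ (E / C)%G by apply: satellite_hereditary fUC; apply: quotientS.
have iso := second_isog nCE; rewrite isog_sym in iso.
apply: formation_quo (formation_isog formf iso fEC) => //.
by rewrite normsI ?normG.
Qed.

(** By construction G / C_G(H / K) acts faithfully on H / K; this makes the
    semidirect product detect membership in the satellite. *)
Lemma chief_sdprod_faithful (gT : finGroupType) (G H K : {group gT}) :
    chief_factor G K H ->
  'C_(sdpair2 (chief_action G H K) @* (G / chief_cent G H K))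
     (sdpair1 (chief_action G H K) @* (H / K)) = 1.
Proof.
move=> chKH; have [_ isoN isoQ actQ] := chief_sdprodP chKH.
case/andP: (chKH) => /maxgroupp/andP[/proper_sub sKH nKG] /andP[sHG nHG].
have nKH := subset_trans sHG nKG.
apply/trivgP/subsetP=> _ /setIP[/morphimP[_ _ /morphimP[x nCx Gx ->] ->] cx].
suffices Cx : x \in chief_cent G H K.
  by rewrite [coset_morphism _ x]coset_id // morph1 inE.
rewrite -cycle_subG chief_centP // cycle_subG Gx -quotient_cents2 //; last first.
  by rewrite cycle_subG (subsetP nKG).
rewrite quotient_cycle ?(subsetP nKG) // cycle_subG.
apply/centP=> _ /morphimP[h nKh Hh ->]; apply: commute_sym.
apply/commgP/conjg_fixP.
have hH : coset K h \in H / K by apply: mem_quotient.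
have hxH : coset K (h ^ x) \in H / K.
  by rewrite mem_quotient // memJ_norm // (subsetP nHG).
have sHD : H / K \subset 'dom (sdpair1_morphism (chief_action G H K)).
  have sCQ : chief_cent G H K \subset 'C(H / K | 'Q) := subsetIr _ _.
  suffices: H / K \subset 'C_(|('J / K)%gact)(chief_cent G H K) by [].
  by rewrite gacentQ centsC; move: sCQ; rewrite sub_astabQ => /andP[].
rewrite -morphJ ?(subsetP nKG x Gx) //.
apply: (injmP (injm_sdpair1 (chief_action G H K))); rewrite ?(subsetP sHD) //.
apply: etrans (esym (actQ h x Hh Gx)) _.
apply/conjg_fixP/commgP/commute_sym/(centP cx).
by rewrite mem_morphim ?(subsetP sHD).
Qed.

Lemma central_chiefP (gT : finGroupType) (G H K : {group gT}) :
    chief_factor G K H -> p.-group (H / K) ->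
  central_chief F G H K <-> f p _ (G / chief_cent G H K)%G.
Proof.
move=> chKH pHK; have [defS isoN isoQ actQ] := chief_sdprodP chKH.
rewrite /central_chief; set S := chief_sdprod G H K in defS *.
have [nsNS sQS defNQ nNQ tiNQ] := sdprod_context defS.
set N := (sdpair1 _ @* (H / K))%G in nsNS defNQ nNQ tiNQ isoN defS.
set Q := (sdpair2 _ @* _)%G in sQS defNQ nNQ tiNQ isoQ defS.
have pN : p.-group N by rewrite -(isog_pgroup p isoN).
split=> [FS | fC].
  have := satellite_cent FS nsNS pN => fS.
  have: f p _ (Q / 1)%G.
    apply: (satellite_sub_quo sQS _ _ _ fS); rewrite ?norms1 //.
      by rewrite normsI ?normG ?norms_cent ?normal_norm.
    apply: subset_trans (setSI _ (subsetIr _ _)) _.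
    by rewrite setIC [_ :&: _](chief_sdprod_faithful chKH).
  have iso1 := quotient1_isog Q.
  rewrite isog_sym in isoQ; apply: formation_isog => //.
  by rewrite isog_sym in iso1; exact: (isog_trans iso1 isoQ).
apply: satellite_sub; apply: (p_extension_closed formf (@pf) nsNS pN).
have isoSN : Q \isog S / N by apply: sdprod_isog defS.
exact: (formation_isog formf (isog_trans isoQ isoSN)).
Qed.
(** By the local definition of F. A chief factor H / K of E is either
    isomorphic to one of E / N, or is covered by N, in which case it is a
    p-factor centralised by C_E(N). *)
Lemma satellite_extension (gT : finGroupType) (E N : {group gT}) :
    N <| E -> p.-group N -> f p _ (E / 'C_E(N))%G -> F _ (E / N)%G -> F _ E.
Proof.
move=> nsNE pN fN FN; have [_ eqF _ _] := locF; apply/eqF; right.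
move=> H K chKH q q_pr qHK.
case/andP: (chKH) => /maxgroupP[/andP[ltKH nKE] maxK] nsHE.
have [[sHE nHE] [sNE nNE]] := (andP nsHE, andP nsNE).
have sKH := proper_sub ltKH; have nKH := subset_trans sHE nKE.
(* Not covered by N: carried over to E / N. *)
have [sHNK | nsHNK] := boolP (H :&: N \subset K).
  have [chq oq commq] := chief_factor_quotient chKH nsNE sHNK.
  rewrite -oq in qHK; have := satellite_chief q_pr FN chq qHK.
  have nKNE := quotient_norms N nKE; have nHNE := quotient_norms N nHE.
  have [L defL sNL nsLE] := inv_quotientN nsNE (chief_cent_normal nKNE nHNE).
  have formq : formation (f q) by have [h _ _ _] := locF; apply: h.
  have iso := third_isog sNL nsNE nsLE; rewrite -defL in iso.
  move/(formation_isog formq iso); apply: formation_quo => //.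
  - exact: normal_norm.
  - by rewrite normal_norm // chief_cent_normal.
  rewrite chief_centP // (normal_sub nsLE) commq // -defL.
  by rewrite chief_cent_comm ?quotientS ?(subset_trans (quotientS _ sHE)).
(* Covered by N: H = (H :&: N) K by maximality of K. *)
have defH : (H :&: N) * K = H.
  have nHNK : H :&: N \subset 'N(K) := subset_trans (subsetIl _ _) nKH.
  apply/eqP; rewrite eqEproper mul_subG ?subsetIl //=.
  apply: contra nsHNK; rewrite -norm_joinEl // => ltH.
  rewrite -(maxK ((H :&: N) <*> K)%G) ?joing_subl ?joing_subr //.
  by rewrite ltH normsY ?normsI.
have defHK : H / K = (H :&: N) / K by rewrite -{1}defH quotientMidr.
have pHK : p.-group (H / K).
  by rewrite defHK quotient_pgroup ?(pgroupS (subsetIr H N)).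
have -> : q = p.
  by apply/eqP; have := pgroupP pHK q q_pr qHK; rewrite inE.
apply: formation_quo fN => //.
- by rewrite normsI ?normG ?norms_cent.
- by rewrite normal_norm // chief_cent_normal.
rewrite chief_centP // subsetIl /= -quotient_cents2 //; last first.
  exact: subset_trans (subsetIl _ _) nKE.
by rewrite defHK quotient_cents // subIset // centS ?orbT // subsetIr.
Qed.

Lemma satellite_extension_section (gT : finGroupType) (E M N : {group gT}) :
    M <| E -> N <| E -> M \subset N -> p.-group (N / M) ->
    f p _ (E / chief_cent E N M)%G -> F _ (E / N)%G -> F _ (E / M)%G.
Proof.
move=> nsME nsNE sMN pNM fNM FN; have [sNE nNE] := andP nsNE.
have nME := normal_norm nsME; have nMN := subset_trans sNE nME.
have isoEN := third_isog sMN nsME nsNE; rewrite isog_sym in isoEN.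
apply: (satellite_extension (quotient_normal M nsNE) pNM); last first.
  exact: (formation_isog formF isoEN FN).
have nsC := chief_cent_normal nME nNE.
have sMC : M \subset chief_cent E N M.
  by rewrite chief_centP // (normal_sub nsME) commg_subl.
have iso := third_isog sMC nsME nsC; rewrite isog_sym in iso.
apply: (formation_quo formf _ _ _ (formation_isog formf iso fNM)).
- by rewrite quotient_norms ?normal_norm.
- by rewrite normsI ?normG ?norms_cent ?quotient_norms.
rewrite subsetI quotientS ?subsetIl //= quotient_cents2 ?chief_cent_comm //.
exact: subset_trans (normal_sub nsC) nME.
Qed.

End AtPrime.

(** * Frattini arguments and F-maximal subgroups *)

(** The hypothesis on proper subgroups says that every maximal subgroup of E
    contains E :&: C, that is, E :&: C is in the Frattini subgroup of E. *)
Lemma Frattini_lift (gT : finGroupType) (E C : {group gT}) :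
    E \subset 'N(C) -> F _ (E / C)%G ->
    (forall X : {group gT}, X \proper E -> ~~ (E \subset C * X)) -> F _ E.
Proof.
move=> nCE FEC minE; apply: satF.
have sCPhi : C :&: E \subset 'Phi(E).
  apply/bigcapsP=> M /predU1P[-> | maxM]; first exact: subsetIr.
  case/maxgroupP: maxM => ltME maxM; have sME := proper_sub ltME.
  apply: contraR (minE M ltME) => nsCEM.
  have /eqP <- : (C :&: E) <*> M == E.
    rewrite eqEproper join_subG subsetIr sME /=.
    apply: contra nsCEM => ltJ.
    by rewrite -(maxM _ ltJ) ?joing_subl ?joing_subr.
  by rewrite -norm_joinEr ?genS ?setSU ?subsetIl ?(subset_trans sME).
have iso := second_isog nCE; rewrite isog_sym in iso.
apply: (formation_quo formF _ _ sCPhi (formation_isog formF iso FEC)).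
- by rewrite normsI ?normG.
- by rewrite gFnorm.
Qed.

Lemma minimal_supplement (gT : finGroupType) (G R : {group gT}) :
    R <| G -> F _ (G / R)%G ->
  exists U : {group gT}, [/\ U \subset G, G \subset R * U & F _ U].
Proof.
move=> nsRG FGR; pose P (A : {group gT}) := (A \subset G) && (G \subset R * A).
have PG : P G by rewrite /P subxx mulG_subr.
have [U /mingroupP[/andP[sUG sGRU] minU] _] := mingroup_exists PG.
have nRU := subset_trans sUG (normal_norm nsRG).
exists U; split=> //; apply: (Frattini_lift nRU) => [|X ltXU].
  suffices -> : (U / R)%G = (G / R)%G by [].
  apply/group_inj/eqP; rewrite eqEsubset /= quotientS // quotientSK //.
  exact: normal_norm.
apply: contraL (ltXU) => sURX; have sXU := proper_sub ltXU.
rewrite -(minU X) ?properxx // /P (subset_trans sXU) //=.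
by apply: subset_trans sGRU _; rewrite -{2}(mulGid R) -mulgA mulgS.
Qed.

Lemma class_maximal_exists (gT : finGroupType) (G E : {group gT}) :
    E \subset G -> F _ E -> exists2 U, class_maximal F G U & E \subset U.
Proof.
move=> sEG FE; pose P (A : {group gT}) := (A \subset G) && `[< F _ A >].
have PE : P E by rewrite /P sEG; apply/asboolP.
have [U /maxgroupP[/andP[sUG /asboolP FU] maxU] sEU] := maxgroup_exists PE.
exists U => //; split=> // V sUV sVG FV.
by apply/esym/maxU => //; rewrite /P sVG; apply/asboolP.
Qed.

Lemma class_maximalJ (gT : finGroupType) (G U : {group gT}) x :
  x \in G -> class_maximal F G U -> class_maximal F G (U :^ x)%G.
Proof.
have FJ (V : {group gT}) y : F _ V -> F _ (V :^ y)%G.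
  by apply: formation_isog => //; apply: conj_isog.
move=> Gx [sUG FU maxU]; split; [by rewrite conj_subG | exact: FJ |].
move=> V sUV sVG FV; rewrite /= (maxU (V :^ x^-1)%G) ?conjsgKV //.
- by rewrite /= -sub_conjg.
- by rewrite conj_subG ?groupV.
- exact: FJ.
Qed.

Lemma class_Int_sub (gT : finGroupType) (G U : {group gT}) :
  class_maximal F G U -> class_Int F G \subset U.
Proof. by move=> maxU; apply: bigcap_inf; apply/asboolP. Qed.

Lemma sub_class_Int (gT : finGroupType) (G N : {group gT}) :
    (forall U : {group gT}, class_maximal F G U -> N \subset U) ->
  N \subset class_Int F G.
Proof. by move=> sNU; apply/bigcapsP=> U /asboolP/sNU. Qed.

Lemma class_Int_normal (gT : finGroupType) (G : {group gT}) :
  F gT 1%G -> class_Int F G <| G.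
Proof.
move=> F1; apply/andP; split.
  have [U maxU _] := class_maximal_exists (sub1G G) F1.
  by apply: subset_trans (class_Int_sub maxU) _; case: maxU.
apply/subsetP=> x Gx; rewrite inE.
apply: (@sub_class_Int _ G (class_Int F G :^ x)%G) => U maxU.
by rewrite /= sub_conjg class_Int_sub //; apply: class_maximalJ; rewrite ?groupV.
Qed.

(** * The hypercentre through normal series *)

Section Hypercentre.

Variable pi : nat_pred.
Hypothesis pi_sub : forall p, p \in pi -> class_prime F p.

(** Hypercentrality quantifies over all chief factors below N. A single normal
    series with good factors carries the same information, but is visibly
    stable under products and can be intersected with, or lifted to, other
    subgroups, without any Jordan-Hoelder comparison of chief factors. *)
Inductive central_series (gT : finGroupType) (G : {group gT}) :
    {group gT} -> Prop :=
  | CentralSeries1 : central_series G 1%G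
  | CentralSeriesStep (M N : {group gT}) :
      central_series G M -> M \subset N -> M <| G -> N <| G ->
      pi^'.-group (N / M) \/
        (exists2 p, p \in pi &
          p.-group (N / M) /\ f p _ (G / chief_cent G N M)%G) ->
      central_series G N.

Lemma central_series_normal (gT : finGroupType) (G N : {group gT}) :
  central_series G N -> N <| G.
Proof. by case=> [|//]; apply: normal1. Qed.

Lemma central_chief_satellite p (gT : finGroupType) (G H K : {group gT}) :
    solvable G -> chief_factor G K H -> p \in pi -> p %| #|H / K| ->
  p.-group (H / K) /\
    (central_chief F G H K <-> f p _ (G / chief_cent G H K)%G).
Proof.
move=> solG chKH pi_p pHK; have [p_pr _] := pi_sub pi_p.
have sHG : H \subset G by case/and3P: chKH.
have [_ ntHK] := minnormal_solvable (chief_factor_minnormal chKH)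
  (quotientS K sHG) (quotient_sol K solG).
case/is_abelemP=> q q_pr /abelem_pgroup qHK.
have pHK' : p.-group (H / K).
  by have := pgroupP qHK p p_pr pHK; rewrite inE => /eqP->.
by split=> //; apply: central_chiefP => //; apply: pi_sub.
Qed.

Lemma hypercentral_series (gT : finGroupType) (G N : {group gT}) :
  solvable G -> N <| G -> hypercentral pi F G N -> central_series G N.
Proof.
move=> solG; have [m] := ubnP #|N|; elim: m N => // m IHm N /ltnSE-leNm nsNG hN.
have [-> | ntN] := eqVneq N 1%G; first exact: CentralSeries1.
have{hN} hN : forall H K : {group gT}, chief_factor G K H -> H \subset N ->
    (exists p, [/\ p \in pi, prime p & p %| #|H / K|]) -> central_chief F G H K.
  by case: hN => // N1; case/eqP: ntN; apply: group_inj.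
have [M maxM]: {M : {group gT} | maxnormal M N G}.
  by apply: ex_maxgroup; exists 1%G; rewrite proper1G ntN norms1.
have /andP[ltMN nMG] := maxgroupp maxM; have sMN := proper_sub ltMN.
have sNG := normal_sub nsNG.
have chMN: chief_factor G M N by rewrite /chief_factor maxM.
have nsMG: M <| G by rewrite /normal nMG andbT (subset_trans sMN).
apply: (CentralSeriesStep (M := M)) => //.
  apply: IHm => //; first exact: leq_trans (proper_card ltMN) _.
  by right=> H K chKH sHM; apply: hN => //; apply: subset_trans sMN.
have [[p pi_p pMN] | no_p] := pselect (exists2 p, p \in pi & p %| #|N / M|).
  right; exists p => //.
  have [pNM cNM] := central_chief_satellite solG chMN pi_p pMN.
  split=> //; apply/cNM; apply: hN => //; exists p; split=> //.
  by case: (pi_sub pi_p).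
left; apply/pgroupP=> q q_pr qNM; rewrite inE; apply/negP=> pi_q.
by case: no_p; exists q.
Qed.

(** The factors of a series of N, multiplied by A, continue a series of A: they
    are quotients of the original ones with larger centralisers. *)
Lemma central_seriesY (gT : finGroupType) (G A N : {group gT}) :
  central_series G A -> central_series G N -> central_series G (A <*> N)%G.
Proof.
move=> cA; have nsAG := central_series_normal cA.
elim=> [|M {}N cM IH sMN nsMG nsNG cNM].
  suffices -> : (A <*> 1)%G = A by []; apply: group_inj; exact: joingG1.
have nsJ (B : {group gT}) : B <| G -> A <*> B <| G.
  by move=> nsBG; apply: normalY.
have [nAG nMG] := (normal_norm nsAG, normal_norm nsMG).
have nNG := normal_norm nsNG.
have nJG := normal_norm (nsJ M nsMG).
have [sAG sNG] := (normal_sub nsAG, normal_sub nsNG).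
have sJ : A <*> M \subset A <*> N by rewrite genS ?setUS.
have defJ : (A <*> N) / (A <*> M) = N / (A <*> M).
  apply/eqP; rewrite eqEsubset [N / _ \subset _]quotientS ?joing_subr // andbT.
  rewrite quotientSK; last by rewrite (subset_trans (normal_sub (nsJ N nsNG))).
  rewrite (norm_joinEr (subset_trans sNG nAG)) mulSg ?joing_subl //.
have homJ : N / (A <*> M) \homg N / M.
  by apply: homg_quotientS; rewrite ?(subset_trans sNG) ?joing_subr.
apply: CentralSeriesStep IH sJ (nsJ M nsMG) (nsJ N nsNG) _.
case: cNM => [pi'NM | [p pi_p [pNM fNM]]].
  by left; rewrite defJ /pgroup (pnat_dvd (card_homg homJ)).
right; exists p => //; split.
  by rewrite defJ /pgroup (pnat_dvd (card_homg homJ)).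
have formf : formation (f p).
  by have [h _ _ _] := locF; apply: h; case: (pi_sub pi_p).
have nJN := normal_norm (nsJ N nsNG).
apply: formation_quo fNM => //; try exact/normal_norm/chief_cent_normal.
have nMN := subset_trans sNG nMG.
have nJNM := subset_trans (normal_sub (nsJ N nsNG)) nJG.
have sCG : chief_cent G N M \subset G := subsetIl _ _.
rewrite chief_centP // sCG -quotient_cents2 ?(subset_trans sCG) //= defJ.
rewrite quotient_cents2 ?(subset_trans sCG) ?(subset_trans sNG) //.
exact: subset_trans (chief_cent_comm nMG nMN) (joing_subr _ _).
Qed.

Lemma hypercentre_series (gT : finGroupType) (G : {group gT}) :
  solvable G -> central_series G (hypercentre pi F G).
Proof.
move=> solG; apply: (big_ind (central_series G)).
- exact: CentralSeries1.
- exact: central_seriesY.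
- by move=> N /andP[nsNG /asboolP]; apply: hypercentral_series.
Qed.

Lemma hypercentral_sub (gT : finGroupType) (G N : {group gT}) :
  N <| G -> hypercentral pi F G N -> N \subset hypercentre pi F G.
Proof.
move=> nsNG hN; rewrite /hypercentre bigprodGE sub_gen //.
by apply: (bigcup_max N) => //; rewrite nsNG; apply/asboolP.
Qed.

(** Induction on the series, descending from E / N to E / M. On a pi'-factor the
    residual of E / M is a soluble pi'-group; on a p-factor E acts through a
    subgroup of a group of f(p). *)
Lemma central_series_lift (gT : finGroupType) (G N : {group gT}) :
    class_sub (class_prod (soluble_pi'_groups pi) F) F ->
    solvable G -> central_series G N ->
  forall E : {group gT}, N \subset E -> E \subset G -> F _ (E / N)%G -> F _ E.
Proof.
move=> piF solG; elim=> [|M {}N cM IH sMN nsMG nsNG cNM] E sNE sEG FEN.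
  by apply: (formation_isog formF _ FEN); rewrite isog_sym quotient1_isog.
apply: IH => //; first exact: subset_trans sNE.
have nsNE := normalS sNE sEG nsNG.
have nsME := normalS (subset_trans sMN sNE) sEG nsMG.
case: cNM => [pi'NM | [p pi_p [pNM fNM]]].
  have sR : residual F (E / M)%G \subset N / M.
    apply: residual_min; first exact: quotient_normal.
    apply: (formation_isog formF _ FEN).
    by rewrite isog_sym; apply: third_isog.
  apply: piF; split; last exact: pgroupS sR pi'NM.
  apply: solvableS sR _; apply: quotient_sol; apply: solvableS solG.
  exact: normal_sub.
have nMG := normal_norm nsMG; have nMN := subset_trans (normal_sub nsNG) nMG.
apply: (satellite_extension_section (pi_sub pi_p) nsME nsNE sMN pNM _ FEN).
have nC1 := normal_norm (chief_cent_normal nMG (normal_norm nsNG)).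
have nC2 := chief_cent_normal (normal_norm nsME) (normal_norm nsNE).
apply: (satellite_sub_quo (pi_sub pi_p) sEG nC1 (normal_norm nC2) _ fNM).
rewrite chief_centP ?(normal_norm nsME) // subsetIr /=.
apply: subset_trans (chief_cent_comm nMG nMN).
exact: commSg (subsetIl _ _).
Qed.

(** * Sufficiency *)

Lemma hypercentre_sub_Int (gT : finGroupType) (G : {group gT}) :
    class_sub (class_prod (soluble_pi'_groups pi) F) F -> solvable G ->
  hypercentre pi F G \subset class_Int F G.
Proof.
move=> piF solG; set Z := hypercentre pi F G.
have cZ := hypercentre_series solG; have nsZG := central_series_normal cZ.
apply: sub_class_Int => U [sUG FU maxU].
have nZU := subset_trans sUG (normal_norm nsZG).
have sUZG : Z <*> U \subset G by rewrite join_subG sUG normal_sub.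
rewrite (maxU (Z <*> U)%G) ?joing_subl ?joing_subr //.
apply: (central_series_lift piF solG cZ) => //; first exact: joing_subl.
apply: formation_homg FU => //=; rewrite quotientYidl //.
exact: quotient_homg.
Qed.

(** A subgroup E of G minimal outside f(p) modulo the centraliser of a p-chief
    factor below Int(G) belongs to F, hence lies in a common F-subgroup with
    this chief factor, where it must act as a group of f(p). *)
Lemma Int_hypercentral (gT : finGroupType) (G : {group gT}) :
    boundary_condition pi F f soluble_groups -> solvable G ->
  hypercentral pi F G (class_Int F G).
Proof.
move=> bndF solG; right=> H K chKH sHI [p [pi_p p_pr pHK]].
have Fp := pi_sub pi_p; set C := chief_cent G H K.
have [pHK' ->] := central_chief_satellite solG chKH pi_p pHK.
case/andP: (chKH) => /maxgroupp/andP[/proper_sub sKH nKG] /andP[sHG nHG].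
have [// | nfGC] := pselect (f p _ (G / C)%G).
pose P (A : {group gT}) := (A \subset G) && `[< ~ f p _ (A / C)%G >].
have PG : P G by rewrite /P subxx; apply/asboolP.
have [E /mingroupP[/andP[sEG /asboolP nfE] minE] _] := mingroup_exists PG.
have nsCG : C <| G := chief_cent_normal nKG nHG.
have nCE := subset_trans sEG (normal_norm nsCG).
have fX (X : {group gT}) : X \proper E -> f p _ (X / C)%G.
  move=> ltXE; have [// | nfX] := pselect (f p _ (X / C)%G).
  case/andP: (ltXE) => sXE /negP[]; rewrite (minE X) //.
  by rewrite /P (subset_trans sXE) //; apply/asboolP.
(* By minimality of E its image in G / C is f(p)-critical. *)
have FEC : F _ (E / C)%G.
  apply: bndF; first by apply: quotient_sol; apply: solvableS solG.
  exists p => //; split=> // Y ltYE.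
  pose X := (E :&: coset C @*^-1 Y)%G.
  have defY : Y = (X / C)%G.
    apply: group_inj; rewrite /= quotient_setIpre.
    exact/esym/setIidPr/proper_sub.
  rewrite defY; apply: fX; rewrite properE subsetIl subsetI subxx /=.
  by rewrite -sub_quotient_pre // (proper_subn ltYE).
(* A proper subgroup supplementing C in E C would have the same image as E,
   against minimality. *)
have FE : F _ E.
  apply: (Frattini_lift nCE FEC) => X ltXE; apply: contra_notN nfE => sECX.
  suffices -> : (E / C)%G = (X / C)%G by apply: fX.
  apply/group_inj/eqP; rewrite eqEsubset /= quotientSK // sECX.
  by rewrite quotientS ?proper_sub.
have [U maxU sEU] := class_maximal_exists sEG FE; have [sUG FU _] := maxU.
have sHU := subset_trans sHI (class_Int_sub maxU).
have sKU := subset_trans sKH sHU.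
have nsHU : H <| U by rewrite /normal sHU (subset_trans sUG).
have nsKU : K <| U by rewrite /normal sKU (subset_trans sUG).
case: nfE.
have fU := satellite_section_cent Fp FU nsKU nsHU sKH pHK'.
have nsCU := chief_cent_normal (normal_norm nsKU) (normal_norm nsHU).
apply: (satellite_sub_quo Fp sEU (normal_norm nsCU) nCE _ fU).
have nKH := subset_trans sHG nKG.
rewrite chief_centP // subIset ?sEG ?orbT //=.
apply: subset_trans (chief_cent_comm (normal_norm nsKU) nKH).
exact: commSg (subsetIl _ _).
Qed.

Lemma hypercentre_eq_Int :
    class_eq F (class_prod (soluble_pi'_groups pi) F) ->
    boundary_condition pi F f soluble_groups ->
    (exists p, p \in pi) ->
  forall (gT : finGroupType) (G : {group gT}), solvable G ->
    hypercentre pi F G :=: class_Int F G.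
Proof.
move=> eqF bndF [p /pi_sub [_ [aT [A [FA _]]]]] gT G solG.
have piF : class_sub (class_prod (soluble_pi'_groups pi) F) F.
  by move=> rT H /eqF.
apply/eqP; rewrite eqEsubset hypercentre_sub_Int //=.
apply: hypercentral_sub; last exact: Int_hypercentral.
by apply: class_Int_normal; apply: formation1 FA _.
Qed.

(** * Necessity *)

(** Intersecting the series with the p-group B leaves only its p-factors, each
    with a centraliser containing the given one; they are glued with
    [satellite_cent_step]. *)
Lemma central_series_cent p (gT : finGroupType) (G B N : {group gT}) :
    p \in pi -> B <| G -> p.-group B -> central_series G N ->
  f p _ (G / 'C_G(B :&: N))%G.
Proof.
move=> pi_p nsBG pB; have Fp := pi_sub pi_p; have [p_pr _] := Fp.
elim=> [|M {}N cM IH sMN nsMG nsNG cNM].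
  by apply: (satellite_has1 Fp); rewrite /= setIg1 cent1T setIT trivg_quotient.
have [nMG nNG] := (normal_norm nsMG, normal_norm nsNG).
have nMN := subset_trans (normal_sub nsNG) nMG.
have sBM : B :&: M \subset B :&: N by apply: setIS.
have [p'NM | [pNM fNM]] :
    p^'.-group (N / M) \/ p.-group (N / M) /\ f p _ (G / chief_cent G N M)%G.
- case: cNM => [pi'NM | [q pi_q [qNM fNM]]].
    by left; apply: pi'_p'group pi'NM _.
  have [-> | neqp] := eqVneq p q; first by right.
  by left; apply: pi_p'group qNM _; rewrite !inE.
- have sBNM : B :&: N \subset M.
    rewrite -quotient_sub1 ?(subset_trans (subsetIr _ _)) //.
    apply/trivgP/card1_trivg/(@pnat_1 p).
      by apply: quotient_pgroup; apply: pgroupS pB; apply: subsetIl.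
    by apply: pgroupS p'NM; rewrite quotientS ?subsetIr.
  suffices -> : (B :&: N)%G = (B :&: M)%G by [].
  by apply/group_inj/eqP; rewrite eqEsubset sBM andbT subsetI subsetIl.
have nsC := chief_cent_normal nMG nNG.
apply: (satellite_cent_step Fp (pgroupS (subsetIl B N) pB) (normalI nsBG nsNG)
  (normalI nsBG nsMG) sBM nsC _ IH fNM).
rewrite subsetI; apply/andP; split.
  apply: subset_trans (subsetIl B N); rewrite commg_subl.
  exact: subset_trans (normal_sub nsC) (normal_norm (normalI nsBG nsNG)).
rewrite commGC; apply: subset_trans (chief_cent_comm nMG nMN).
by rewrite commgS ?subsetIr.
Qed.

Hypothesis pi_nonempty : exists p, p \in pi.
Hypothesis eqZInt : forall (gT : finGroupType) (G : {group gT}), solvable G ->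
  hypercentre pi F G :=: class_Int F G.

Let F1 (gT : finGroupType) : F gT 1%G.
Proof.
have [p /pi_sub[_ [aT [A [FA _]]]]] := pi_nonempty.
exact: formation1 FA _.
Qed.

(** If no group of F had order divisible by p, then p would not be in pi and the
    group of order p would be its own hypercentre, while its only F-subgroup
    would be trivial. *)
Lemma class_prime_of_eq p : prime p -> class_prime F p.
Proof.
move=> p_pr; have [// | nFp] := pselect (class_prime F p).
pose G := [set: 'Z_p]%G.
have oG : #|G| = p by rewrite cardsT card_ord Zp_cast ?prime_gt1.
have abG : abelian G by apply: FinRing.zmod_abelian.
have solG : solvable G by apply: abelian_sol.
have hG : hypercentral pi F G G.
  right=> H K /andP[_ nsHG] _ [q [pi_q q_pr qHK]]; case: nFp.
  suffices <- : q = p by apply: pi_sub.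
  apply/eqP; rewrite -dvdn_prime2 // -oG.
  apply: dvdn_trans qHK (dvdn_trans (dvdn_quotient _ _) _).
  exact/cardSg/normal_sub.
have [U maxU _] := class_maximal_exists (sub1G G) (F1 _).
have sGU : G \subset U.
  apply: subset_trans (class_Int_sub maxU).
  by rewrite -eqZInt // hypercentral_sub.
split=> //; exists _, U; case: maxU => sUG FU _; split=> //.
by rewrite -{1}oG cardSg.
Qed.

(** Every chief factor of a nilpotent group is central, so that the groups to be
    tested against the satellite are trivial. *)
Lemma nilpotent_of_eq : class_sub nilpotent_groups F.
Proof.
move=> gT G nilG; have [_ eqF _ _] := locF; apply/eqF; right.
move=> H K chKH q q_pr qHK.
case/andP: (chKH) => /maxgroupp/andP[/proper_sub sKH nKG] /andP[sHG nHG].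
have nKH := subset_trans sHG nKG.
apply: (satellite_has1 (class_prime_of_eq q_pr)).
apply: quotientS1; rewrite chief_centP // subxx -quotient_cents2 //.
have /mingroupP[/andP[ntHK _] minHK] := chief_factor_minnormal chKH.
have nsHK : H / K <| G / K by apply: quotient_normal; apply/andP.
rewrite centsC; have sZ := subsetIr (H / K) 'Z(G / K).
have <- : H / K :&: 'Z(G / K) = H / K.
  apply: (minHK (H / K :&: 'Z(G / K))%G); last exact: subsetIl.
  rewrite meet_center_nil ?quotient_nil //=.
  by rewrite normsI ?(normal_norm nsHK) // gFnorm.
by apply: subset_trans sZ (subsetIr _ _).
Qed.

(** The residual is hypercentral because no chief factor below it has order
    divisible by a prime of pi. An F-subgroup that supplements it extends to an
    F-maximal subgroup, which contains Int(G), hence the whole of G. *)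
Lemma class_prod_of_eq : class_eq F (class_prod (soluble_pi'_groups pi) F).
Proof.
move=> gT G; split=> [FG | [solR pi'R]].
  have R1 : residual F G :=: 1.
    apply/trivgP; apply: (residual_min (normal1 G)).
    by apply: (formation_isog formF _ FG); apply: quotient1_isog.
  rewrite /class_prod /soluble_pi'_groups.
  have -> : residual F G = 1%G by apply: group_inj.
  by split; [apply: solvable1 | apply: pgroup1].
set R := residual F G in solR pi'R.
have FGR : F _ (G / R)%G := formation_residual formF G (F1 gT).
have sRG : R \subset G.
  apply: (residual_min (normal_refl G)).
  by apply: (formation1 formF (F1 gT)); apply: trivg_quotient.
have nsRG : R <| G by rewrite /normal sRG residual_norm.
have solG : solvable G by rewrite (series_sol nsRG) solR; apply: solF FGR.
have hR : hypercentral pi F G R.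
  right=> H K chKH sHR [p [pi_p p_pr pHK]].
  suffices pR : p %| #|R|.
    by have := pgroupP pi'R p p_pr pR; rewrite inE /= pi_p.
  exact: dvdn_trans pHK (dvdn_trans (dvdn_quotient _ _) (cardSg sHR)).
have [U [sUG sGRU FU]] := minimal_supplement nsRG FGR.
have [V maxV sUV] := class_maximal_exists sUG FU.
have sRV : R \subset V.
  apply: subset_trans (class_Int_sub maxV).
  by rewrite -eqZInt // hypercentral_sub.
have [sVG FV _] := maxV.
suffices -> : G = V by [].
by apply/group_inj/eqP; rewrite eqEsubset sVG andbT (subset_trans sGRU) ?mul_subG.
Qed.

(** With B a faithful module for a critical group G outside F and W = B G, an
    F-subgroup cannot cover W / B, so it covers a proper subgroup, which is in
    f(p); this puts B in every F-maximal subgroup of W. *)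
Lemma boundary_of_eq : boundary_condition pi F f soluble_groups.
Proof.
move=> gT G solG [p pi_p [nfG fX]].
have Fp := pi_sub pi_p; have [p_pr _] := Fp.
have formf : formation (f p) by have [h _ _ _] := locF; apply: h.
have pf (rT : finGroupType) (H : {group rT}) : f p _ (H / 'O_p(H))%G -> f p _ H.
  by have [_ _ _ h] := locF; apply: h.
have [// | nFG] := pselect (F _ G); case: nfG.
have [wT [W [B [Q [defW [pB _] CQB isoGQ]]]]] := faithful_module_exists G p_pr.
have [nsBW sQW defBQ nBQ tiBQ] := sdprod_context defW.
have [sBW nBW] := andP nsBW.
have isoQ : Q \isog W / B by apply: sdprod_isog defW.
have isoWG : W / B \isog G by rewrite isog_sym; apply: isog_trans isoGQ isoQ.
have solW : solvable W.
  by rewrite (series_sol nsBW) (pgroup_sol pB) (isog_sol isoWG).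
have sBZ : B \subset hypercentre pi F W.
  rewrite eqZInt //; apply: sub_class_Int => U [sUW FU maxU].
  have nBU := subset_trans sUW nBW.
  have sBUW : B <*> U \subset W by rewrite join_subG sBW.
  have ltUW : (U / B)%G \proper (W / B)%G.
    rewrite properE quotientS //; apply/negP => sWU; apply: nFG.
    have defU : (W / B)%G = (U / B)%G.
      by apply/group_inj/eqP; rewrite eqEsubset sWU quotientS.
    apply: (formation_isog formF isoWG); rewrite defU.
    by apply: formation_homg FU => //; apply: quotient_homg.
  have [g injg imG] := isogP isoWG.
  have fgU : f p _ (g @* (U / B))%G.
    by apply: fX; rewrite /= -imG injm_proper ?quotientS.
  have isoU : g @* (U / B) \isog U / B.
    by rewrite isog_sym; apply: sub_isog => //; apply: quotientS.
  rewrite (maxU (B <*> U)%G) ?joing_subl ?joing_subr //.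
  apply: (satellite_sub Fp).
  apply: (p_extension_closed formf pf _ pB (P := B)).
    by rewrite /normal joing_subl join_subG normG.
  suffices -> : (B <*> U / B)%G = (U / B)%G.
    exact: (formation_isog formf isoU).
  by apply: group_inj; rewrite /= quotientYidl.
have := central_series_cent pi_p nsBW pB (hypercentre_series solW).
have -> : (B :&: hypercentre pi F W)%G = B by apply/group_inj/setIidPl.
move=> fW; have fQ1 : f p _ (Q / 1)%G.
  apply: (satellite_sub_quo Fp sQW _ _ _ fW); rewrite ?norms1 //.
    by rewrite normsI ?normG ?norms_cent.
  apply: subset_trans (setSI _ (subsetIr _ _)) _.
  by rewrite setIC [_ :&: _]CQB.
apply: (formation_isog formf _ fQ1).
by rewrite isog_sym; apply: isog_trans isoGQ (quotient1_isog Q).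
Qed.

End Hypercentre.

End Main.

Theorem theoremB (F : group_class) (Fsat : nat -> group_class) (pi : nat_pred)
    (F_formation : formation F) (F_saturated : saturated F)
    (F_hereditary : hereditary F) (F_soluble : class_sub F soluble_groups)
    (F_neq1 : ~ class_eq trivial_groups F) (F_neqS : ~ class_eq F soluble_groups)
    (F_satellite : canonical_local_satellite F Fsat)
    (pi_sub : forall p, p \in pi -> class_prime F p)
    (pi_nonempty : exists p, p \in pi) :
  (forall (gT : finGroupType) (G : {group gT}), solvable G ->
     hypercentre pi F G :=: class_Int F G)
  <->
  [/\ class_sub nilpotent_groups F,
      class_eq F (class_prod (soluble_pi'_groups pi) F)
    & boundary_condition pi F Fsat soluble_groups].
Proof.
split=> [eqZInt | [_ eqF bndF]].
  split.
  - exact: (nilpotent_of_eq F_formation F_hereditary F_satellite pi_sub).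
  - exact: (class_prod_of_eq F_formation F_saturated).
  - exact: (boundary_of_eq F_formation F_hereditary F_satellite pi_sub).
exact: (hypercentre_eq_Int F_formation F_saturated F_hereditary F_satellite).
Qed.
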